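(* Let $n\geq3$, let $\mathbf{M}=(M_1,M_2)\in\mathcal{M}^{1,n-1}_n$ be a plurimatroid, let $\mathcal{B}_1,\mathcal{B}_2$ be the sets of bases of $M_1,M_2$, and put $K_1=\{k\in[n]:\{k\}\in\mathcal{B}_1\}$ and $K_2=\{k\in[n]:[n]\setminus\{k\}\in\mathcal{B}_2\}$. Let $\mathbb{F}_{\mathbf{M}}$ be the associated thin Schubert cell in the flag variety $\mathbb{F}_{1<n-1}(\mathbb{C}^n)$. The following statements are equivalent: (1) $\mathbb{F}_{\mathbf{M}}$ is nonempty. (2) $\mathbf{M}$ is a flag matroid of rank $\mathbf{r}=(1,n-1)$. (3) $|K_1\cap K_2|\neq1$. Moreover: $\mathbb{F}_{\mathbf{M}}$ is complete if and only if $|K_1\cap K_2|=0$; and $\mathbb{F}_{\mathbf{M}}$ is proper if and only if $|K_1\cap K_2|\geq2$.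
   Context: $[n]=\{1,\dots,n\}$ and $\binom{[n]}{d}$ is the set of $d$-element subsets of $[n]$. A matroid of rank $d$ on $n$ elements is a pair $M=([n],\mathcal{B})$ with $\emptyset\neq\mathcal{B}\subset\binom{[n]}{d}$ such that for all $I,J\in\mathcal{B}$ and $i\in I\setminus J$ there is $j\in J\setminus I$ with $(I\setminus\{i\})\cup\{j\}\in\mathcal{B}$; the elements of $\mathcal{B}$ are its bases. $\mathcal{M}^d_n$ is the set of such matroids and $\mathcal{M}^{1,n-1}_n=\mathcal{M}^1_n\times\mathcal{M}^{n-1}_n$; its elements are called plurimatroids. For a matroid $M=([n],\mathcal{B})$ and $S\subseteq[n]$: $r(S)=\max_{B\in\mathcal{B}}|S\cap B|$, $\mathrm{cl}(S)=\{i\in[n]:r(S\cup\{i\})=r(S)\}$, and $\mathrm{Flats}(M)=\{S\subseteq[n]:\mathrm{cl}(S)=S\}$. A plurimatroid $(M_1,M_2)\in\mathcal{M}^{1,n-1}_n$ is a flag matroid of rank $(1,n-1)$ if $\mathrm{Flats}(M_1)\subset\mathrm{Flats}(M_2)$. $G(d,n)$ is the Grassmannian of $d$-dimensional subspaces of $\mathbb{C}^n$ with Plücker coordinates $(p_I)$; for $M=([n],\mathcal{B})\in\mathcal{M}^d_n$, $G_M=\{W\in G(d,n):p_I(W)\neq0\Leftrightarrow I\in\mathcal{B}\}$. $\mathbb{F}_{1<n-1}(\mathbb{C}^n)=\{(W_1,W_2)\in G(1,n)\times G(n-1,n):W_1\subset W_2\}$ and $\mathbb{F}_{\mathbf{M}}=(G_{M_1}\times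 G_{M_2})\cap\mathbb{F}_{1<n-1}(\mathbb{C}^n)$. The cell $\mathbb{F}_{\mathbf{M}}$ is called complete if $\mathbb{F}_{\mathbf{M}}=G_{M_1}\times G_{M_2}$, and proper if $\mathbb{F}_{\mathbf{M}}\subsetneq G_{M_1}\times G_{M_2}$.
   Formalization: The last clause is proved as ''the cell is nonempty and proper iff |K_1∩K_2| ≥ 2'': as written it fails when |K_1∩K_2| = 1, where the cell is empty, hence strictly contained in the nonempty product G_{M_1}×G_{M_2}. *)

(* Defs.v *)
From HB Require Import structures.
From mathcomp Require Import all_boot all_order all_algebra.

Set Implicit Arguments.
Unset Strict Implicit.
Unset Printing Implicit Defensive.

Import GRing.Theory.

Section Matroids.
Local Open Scope set_scope.
Variable n : nat.

(* The ground set [n] = {1, ..., n} is 'I_n = {0, ..., n - 1}. *)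
Record matroid (d : nat) := Matroid {
  bases :> {set {set 'I_n}};
  bases_neq0 : bases != set0;
  card_bases : forall B, B \in bases -> #|B| = d;
  bases_exchange : forall I J, I \in bases -> J \in bases ->
    forall i, i \in I :\: J ->
    exists2 j, j \in J :\: I & j |: (I :\ i) \in bases }.

Definition matroid_rank d (M : matroid d) (S : {set 'I_n}) : nat :=
  \max_(B in bases M) #|S :&: B|.

Definition matroid_closure d (M : matroid d) (S : {set 'I_n}) : {set 'I_n} :=
  [set i | matroid_rank M (i |: S) == matroid_rank M S].

Definition flats d (M : matroid d) : {set {set 'I_n}} :=
  [set S | matroid_closure M S == S].

Definition plurimatroid : Type := (matroid 1 * matroid n.-1)%type.

Definition is_flag_matroid (M : plurimatroid) : bool :=
  flats M.1 \subset flats M.2.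

Definition K1 (M : plurimatroid) : {set 'I_n} :=
  [set k | [set k] \in bases M.1].

Definition K2 (M : plurimatroid) : {set 'I_n} :=
  [set k | [set~ k] \in bases M.2].

End Matroids.

(* Loaded only here so that the [set _ | _] notations above are those of finset. *)
From mathcomp Require Import all_classical all_reals complex.

Section ThinSchubertCells.
Local Open Scope ring_scope.
Local Open Scope classical_set_scope.
(* [R[i]] is the field of complex numbers. *)
Variables (R : realType) (n : nat).

Definition grassmannian (d : nat) : set {vspace 'rV[R[i]]_n} :=
  [set W | \dim W = d].

(* For #|I| = \dim W: the minor with columns I (in increasing order) of the
   matrix whose rows are the basis [vbasis W].  Another basis multiplies all
   the coordinates by a common nonzero scalar, so only their vanishing is
   intrinsic to W.  The value is junk when #|I| <> \dim W. *)
Definition plucker (W : {vspace 'rV[R[i]]_n}) (I : {set 'I_n}) : R[i] :=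
  \det (\matrix_(i < #|I|, j < #|I|) (vbasis W)`_i ord0 (enum_val j)).

Definition thin_cell d (M : matroid n d) : set {vspace 'rV[R[i]]_n} :=
  [set W | grassmannian d W /\
     forall I : {set 'I_n}, #|I| = d -> plucker W I != 0 <-> I \in bases M].

Definition flag_variety :
    set ({vspace 'rV[R[i]]_n} * {vspace 'rV[R[i]]_n}) :=
  [set W | [/\ grassmannian 1 W.1, grassmannian n.-1 W.2
             & (W.1 <= W.2)%VS]].

Definition thin_cell_prod (M : plurimatroid n) :
    set ({vspace 'rV[R[i]]_n} * {vspace 'rV[R[i]]_n}) :=
  thin_cell M.1 `*` thin_cell M.2.

Definition flag_cell (M : plurimatroid n) :
    set ({vspace 'rV[R[i]]_n} * {vspace 'rV[R[i]]_n}) :=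
  thin_cell_prod M `&` flag_variety.

Definition complete_cell (M : plurimatroid n) : Prop :=
  flag_cell M = thin_cell_prod M.

(* An empty cell also satisfies this (thin cells of rank 1 and n - 1 are never
   empty), hence nonemptiness must be required separately where it is meant. *)
Definition proper_cell (M : plurimatroid n) : Prop :=
  flag_cell M `<` thin_cell_prod M.

End ThinSchubertCells.

Arguments flag_cell R {n} M.
Arguments complete_cell R {n} M.
Arguments proper_cell R {n} M.

(* Main.v *)
(* A plurimatroid of rank (1, n - 1) is determined by K1 and K2.  The flats of
   M1 are [n] and the complement of K1, and the latter fails to be a flat of M2
   exactly when adding some i in K1 completes it to a superset of K2, that is
   when K1 :&: K2 = {i}.  On the linear side, a point of the product of the thin
   cells is a line <[v]> with supp v = K1 together with a hyperplane u^perp with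
   supp u = K2, and incidence is the vanishing of the sum of v_k u_k over
   K1 :&: K2.  This sum is empty if the intersection is, a single nonzero term if
   it is a singleton, and can be made both zero and nonzero otherwise. *)
Require Import Defs.
From mathcomp Require Import all_boot all_order all_algebra.
From mathcomp Require Import zify.

Set Implicit Arguments.
Unset Strict Implicit.
Unset Printing Implicit Defensive.

Import GRing.Theory Num.Theory.

(** * Ranks and flats of a plurimatroid expressed through [K1] and [K2] *)

Section FlatsOfPlurimatroids.
Variable n : nat.
Implicit Types (S : {set 'I_n}).

Lemma mem_flats d (M : matroid n d) S :
  (S \in flats M) =
  [forall (i | i \notin S), matroid_rank M (i |: S) != matroid_rank M S].
Proof.
rewrite inE; apply/eqP/forall_inP => [clS i | H].
  by apply: contraNneq => eq_rank; rewrite -clS inE eq_rank.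
apply/setP=> i; rewrite inE; case: (boolP (i \in S)) => [iS|/H/negbTE//].
by rewrite (setUidPr _) ?eqxx ?sub1set.
Qed.

Lemma setT_flats d (M : matroid n d) : [set: 'I_n] \in flats M.
Proof. by rewrite mem_flats; apply/forall_inP => i; rewrite inE. Qed.

Variable M : plurimatroid n.

Lemma bases1P (B : {set 'I_n}) :
  reflect (exists2 k, k \in K1 M & B = [set k]) (B \in bases M.1).
Proof.
apply: (iffP idP) => [BM|[k + ->]]; last by rewrite inE.
have /eqP/cards1P[k Bk] := card_bases BM.
by exists k; rewrite // inE -Bk.
Qed.

Lemma bases2P (B : {set 'I_n}) : (0 < n)%N ->
  reflect (exists2 k, k \in K2 M & B = [set~ k]) (B \in bases M.2).
Proof.
move=> n_gt0; apply: (iffP idP) => [BM|[k + ->]]; last by rewrite inE.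
have /cards1P[k Bk]: #|~: B| == 1%N.
  by have := cardsC B; rewrite (card_bases BM) card_ord => ?; apply/eqP; lia.
have BE : B = [set~ k] by rewrite -Bk setCK.
by exists k; rewrite // inE -BE.
Qed.

Lemma K1_neq0 : K1 M != set0.
Proof.
have /set0Pn[B /bases1P[k kK _]] := bases_neq0 M.1.
by apply/set0Pn; exists k.
Qed.

Lemma K2_neq0 : (0 < n)%N -> K2 M != set0.
Proof.
move=> n_gt0; have /set0Pn[B /(bases2P _ n_gt0)[k kK _]] := bases_neq0 M.2.
by apply/set0Pn; exists k.
Qed.

Lemma matroid_rank1 S : matroid_rank M.1 S = ~~ [disjoint S & K1 M].
Proof.
apply/eqP; rewrite eqn_leq; apply/andP; split.
  apply/bigmax_leqP => B /bases1P[k kK ->].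
  rewrite setIC; case: (boolP (k \in S)) => kS.
    suff -> : [disjoint S & K1 M] = false.
      by rewrite (leq_trans (subset_leq_card (subsetIl _ _))) ?cards1.
    by apply/negbTE/pred0Pn; exists k; rewrite /= kS.
  suff -> : [set k] :&: S = set0 by rewrite cards0.
  by apply/setP=> i; rewrite !inE; case: eqP => // ->; exact/negbTE.
case: (boolP [disjoint _ & _]) => // /pred0Pn[k /= /andP[kS kK]].
apply: (bigmax_sup [set k]); first by apply/bases1P; exists k.
by rewrite card_gt0; apply/set0Pn; exists k; rewrite !inE kS eqxx.
Qed.

(** A basis [[set~ k]] loses at most the element [k] of [S]. The loss is avoided by choosing [k] in
    [K2 M] outside [S], which fails exactly when [K2 M \subset S]; this boolean is read as 0 or
    1. *)
Lemma matroid_rank2 S : (0 < n)%N ->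
  matroid_rank M.2 S = (#|S| - (K2 M \subset S))%N.
Proof.
move=> n_gt0.
have cardI k : #|S :&: [set~ k]| = (#|S| - (k \in S))%N.
  by rewrite -setDE (cardsD1 k S) addKn.
apply/eqP; rewrite eqn_leq; apply/andP; split.
  apply/bigmax_leqP => B /(bases2P _ n_gt0)[k kK ->]; rewrite cardI.
  apply: leq_sub2l; case: (boolP (_ \subset _)) => // /subsetP/(_ k kK) ->.
  by [].
suff [k kK kS] : exists2 k, k \in K2 M & (k \in S) = (K2 M \subset S).
  apply: (bigmax_sup [set~ k]); first by apply/(bases2P _ n_gt0); exists k.
  by rewrite cardI kS.
case: (boolP (_ \subset _)) => [/subsetP KS|/subsetPn[k kK /negbTE kS]].
  by have /set0Pn[k kK] := K2_neq0 n_gt0; exists k; rewrite // KS.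
by exists k.
Qed.

(** The rank takes only the values 0 and 1. A flat meeting [K1 M] already has full rank and absorbs
    everything; a flat disjoint from [K1 M] absorbs all elements outside [K1 M]. *)
Lemma flats1 : flats M.1 = [set [set: 'I_n]; ~: K1 M].
Proof.
apply/setP=> S; rewrite mem_flats !inE.
apply/forall_inP/orP => [H|[/eqP-> i|/eqP-> i]]; last 2 first.
- by rewrite inE.
- rewrite !inE negbK => iK; rewrite !matroid_rank1.
  have -> : [disjoint ~: K1 M & K1 M].
    by rewrite disjoints_subset.
  have -> // : [disjoint i |: ~: K1 M & K1 M] = false.
  by apply/negbTE/pred0Pn; exists i; rewrite /= !inE eqxx.
case: (boolP [disjoint S & K1 M]) => SK; last first.
  left; apply/eqP/setP=> i; rewrite inE; apply: contraTT isT => /H.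
  rewrite !matroid_rank1 (negbTE SK).
  have -> // : [disjoint i |: S & K1 M] = false.
  by apply: contraNF SK; apply: disjointWl; rewrite subsetUr.
right; apply/eqP/setP=> i; rewrite inE; case: (boolP (i \in S)) => iS.
  by rewrite (disjointFr SK).
apply/esym/negbTE; rewrite negbK; move: (H i iS); apply: contraNT => iK.
have SiK : [disjoint i |: S & K1 M].
  by rewrite disjoints_subset subUset sub1set inE iK -disjoints_subset.
by rewrite !matroid_rank1 SK SiK.
Qed.

Lemma is_flag_matroidE : (0 < n)%N ->
  is_flag_matroid M = (#|K1 M :&: K2 M| != 1%N).
Proof.
move=> n_gt0; rewrite /is_flag_matroid flats1 subUset !sub1set setT_flats /=.
rewrite mem_flats; apply/forall_inP/idP => [H|].
  apply/negP => /cards1P[k Kk].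
  have : k \in K1 M :&: K2 M by rewrite Kk set11.
  rewrite inE => /andP[k1 k2].
  have kC : k \notin ~: K1 M by rewrite inE negbK.
  move: (H k kC); rewrite !matroid_rank2 // cardsU1 kC.
  (* Adding [k] increases the cardinality by one, but it also completes a superset of [K2 M], so the
     rank stays the same. *)
  suff [-> ->] : K2 M \subset k |: ~: K1 M /\ (K2 M \subset ~: K1 M) = false.
    by rewrite addKn subn0 eqxx.
  split; last by apply/negbTE/subsetPn; exists k.
  apply/subsetP=> j j2; rewrite in_setU1 in_setC.
  case: (boolP (j \in K1 M)) => j1; last by rewrite orbT.
  have : j \in K1 M :&: K2 M by rewrite inE j1.
  by rewrite Kk inE => ->.
move=> card_neq1 i; rewrite inE negbK => i1.
have iC : i \notin ~: K1 M by rewrite inE negbK.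
rewrite !matroid_rank2 // cardsU1 iC; apply: contraNN card_neq1 => /eqP eq_rank.
(* Subtraction in [nat] truncates: without this bound, equal ranks would also be compatible with
   both inclusions holding and [~: K1 M] empty. *)
have C_gt0 : K2 M \subset ~: K1 M -> (0 < #|~: K1 M|)%N.
  by move/subset_leq_card; apply: leq_trans; rewrite card_gt0 K2_neq0.
have [sKi nsK] : K2 M \subset i |: ~: K1 M /\ ~~ (K2 M \subset ~: K1 M).
  move: eq_rank C_gt0; do 2!case: (_ \subset _) => //=; lia.
have KI_sub : K1 M :&: K2 M \subset [set i].
  apply/subsetP=> j; rewrite in_setI => /andP[j1 /(subsetP sKi)].
  by rewrite in_setU1 in_setC j1 orbF in_set1.
have /subsetPn[j j2] := nsK; rewrite in_setC negbK => j1.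
have jI : j \in K1 M :&: K2 M by rewrite inE j1.
apply/cards1P; exists i; apply/eqP; rewrite eqEsubset KI_sub sub1set.
by have := subsetP KI_sub j jI; rewrite inE => /eqP <-.
Qed.

End FlatsOfPlurimatroids.

(** * Vanishing of minors, and hyperplanes given by normal vectors *)

Section LinesAndHyperplanes.
Local Open Scope ring_scope.
Variables (F : fieldType) (n : nat).
Implicit Types (W : {vspace 'rV[F]_n}) (I : {set 'I_n}).
Implicit Types (v w : 'rV[F]_n) (u : 'cV[F]_n).

(* A nonzero row relation of the square submatrix is the coordinate vector of
   a nonzero element of W vanishing on I. *)
Lemma basis_minor_eq0P W I (X : #|I|.-tuple 'rV[F]_n) : basis_of W X ->
  reflect (exists2 w, w \in W & w != 0 /\ {in I, forall k, w 0 k = 0})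
    (\det (\matrix_(i < #|I|, j < #|I|) X`_i 0 (enum_val j)) == 0).
Proof.
move=> bX; set A := (X in \det X).
have mulA (c : 'rV_#|I|) j :
    (c *m A) 0 j = (\sum_(i < #|I|) c 0 i *: X`_i) 0 (enum_val j).
  by rewrite mxE summxE; apply: eq_bigr => i _; rewrite !mxE.
apply: (iffP det0P) => [[c c_neq0 cA0]|[w wW [w_neq0 wI]]].
  exists (\sum_(i < #|I|) c 0 i *: X`_i).
    apply: memv_suml => i _; apply: memvZ; apply: (basis_mem bX).
    by rewrite mem_nth ?size_tuple.
  split.
    apply: contra_neq c_neq0 => /(freeP (basis_free bX)) c0.
    by apply/rowP=> i; rewrite c0 mxE.
  by move=> k kI; rewrite -(enum_rankK_in kI kI) -mulA cA0 mxE.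
pose c : 'rV_#|I| := \row_i coord X i w.
have wE : w = \sum_(i < #|I|) c 0 i *: X`_i.
  by rewrite {1}(coord_basis bX wW); apply: eq_bigr => i _; rewrite mxE.
exists c.
  apply: contra_neq w_neq0 => c0; rewrite wE c0.
  by apply: big1 => i _; rewrite mxE scale0r.
by apply/rowP=> j; rewrite mulA -wE wI ?mxE ?enum_valP.
Qed.

(** [vbasis W] has length [\dim W]; casting it to length [#|I|] leaves the underlying sequence,
    hence the matrix, unchanged. *)
Lemma vbasis_minor_eq0P W I : #|I| = \dim W ->
  reflect (exists2 w, w \in W & w != 0 /\ {in I, forall k, w 0 k = 0})
    (\det (\matrix_(i < #|I|, j < #|I|) (vbasis W)`_i 0 (enum_val j)) == 0).
Proof.
move=> cI; have eX : tcast (esym cI) (vbasis W) = vbasis W :> seq _.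
  exact: val_tcast.
by rewrite -eX; apply: basis_minor_eq0P; rewrite eX vbasisP.
Qed.

(** The orthogonal of [u] for the bilinear pairing, without conjugation. It is the whole space when
    [u = 0]. *)
Definition hyperplane u : {vspace 'rV[F]_n} := lker (linfun (mulmxr u)).

Lemma mem_hyperplane u w : (w \in hyperplane u) = (\sum_k w 0 k * u k 0 == 0).
Proof.
rewrite memv_ker lfunE /=; apply/eqP/eqP => [/matrixP/(_ 0 0)|wu0].
  by rewrite !mxE.
by apply/matrixP=> i j; rewrite !ord1 !mxE.
Qed.

Lemma delta_hyperplane u k : (delta_mx 0 k \in hyperplane u) = (u k 0 == 0).
Proof.
rewrite mem_hyperplane (bigD1 k) //= mxE !eqxx mul1r big1 ?addr0 // => j jk.
by rewrite mxE (negbTE jk) mul0r.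
Qed.

(** Rank-nullity: the image has dimension at most 1, and a zero image would put every [delta_mx 0 k]
    in the kernel, forcing [u = 0]. *)
Lemma dim_hyperplane u : u != 0 -> \dim (hyperplane u) = n.-1.
Proof.
move=> u_neq0; pose f : 'Hom('rV[F]_n, 'rV[F]_1) := linfun (mulmxr u).
have := limg_ker_dim f fullv.
have dim_rV m : \dim {:'rV[F]_m} = m by rewrite dimvf; apply: mul1n.
rewrite capfv dim_rV -[lker f]/(hyperplane u).
have : (\dim (f @: fullv) <= 1)%N.
  by rewrite (leq_trans (dimvS (subvf _))) // dim_rV.
suff : (f @: fullv)%VS != 0%VS.
  by rewrite -dimv_eq0; case: (\dim _) => [|[|d]] // _ _ /(congr1 predn); rewrite addn1.
rewrite -lkerE; apply: contra u_neq0 => /subvP sub0.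
apply/eqP/colP=> k; rewrite mxE; apply/eqP.
by rewrite -delta_hyperplane sub0 ?memvf.
Qed.

(** The matrix with the basis vectors as columns has [n] rows and only [n.-1] columns, so some
    nonzero row kills it. Its transpose is a normal vector, and equal dimensions turn the inclusion
    into an equality. *)
Lemma hyperplaneP W : (0 < n)%N -> \dim W = n.-1 ->
  exists2 u, u != 0 & W = hyperplane u.
Proof.
move=> n_gt0 dimW.
pose A : 'M[F]_(n, \dim W) := \matrix_(k, i) (vbasis W)`_i 0 k.
have kerA_neq0 : kermx A != 0.
  rewrite -mxrank_eq0 mxrank_ker -lt0n subn_gt0.
  by rewrite (leq_ltn_trans (rank_leq_col A)) // dimW prednK.
pose r := nz_row (kermx A); exists r^T.
  by rewrite trmx_eq0 nz_row_eq0.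
have rA0 : r *m A = 0 by apply/sub_kermxP; exact: nz_row_sub.
apply/eqP; rewrite eqEdim dim_hyperplane ?trmx_eq0 ?nz_row_eq0 // dimW leqnn andbT.
rewrite -[X in (X <= _)%VS](span_basis (vbasisP W)); apply/span_subvP=> x.
move=> /tnthP[i ->]; rewrite mem_hyperplane.
have /matrixP/(_ 0 i) := rA0; rewrite !mxE => rAi; apply/eqP; rewrite -[RHS]rAi.
by apply: eq_bigr => k _; rewrite !mxE mulrC (tnth_nth 0).
Qed.

End LinesAndHyperplanes.

(** * Pairings of vectors with prescribed supports *)

Section SupportedVectors.
Local Open Scope ring_scope.
Variables (F : numFieldType) (n : nat) (A B : {set 'I_n}).

Lemma sum_support (v : 'rV[F]_n) (u : 'cV[F]_n) :
  (forall k, (v 0 k != 0) = (k \in A)) -> (forall k, (u k 0 != 0) = (k \in B)) ->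
  \sum_k v 0 k * u k 0 = \sum_(k in A :&: B) v 0 k * u k 0.
Proof.
move=> vA uB; rewrite [RHS]big_mkcond; apply: eq_bigr => k _.
rewrite inE -vA -uB; case: (v 0 k =P 0) => [->|_]; first by rewrite mul0r.
by case: (u k 0 =P 0) => [->|_]; first by rewrite mulr0.
Qed.

(** Indicator vectors work. In characteristic zero their pairing vanishes only if [A] and [B] are
    disjoint. *)
Lemma exists_support_sum_card : exists v : 'rV[F]_n, exists u : 'cV[F]_n,
  [/\ forall k, (v 0 k != 0) = (k \in A), forall k, (u k 0 != 0) = (k \in B)
    & \sum_k v 0 k * u k 0 = #|A :&: B|%:R].
Proof.
exists (\row_k (k \in A)%:R), (\col_k (k \in B)%:R).
have vA k : ((\row_k (k \in A)%:R : 'rV[F]_n) 0 k != 0) = (k \in A).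
  by rewrite mxE pnatr_eq0 eqb0 negbK.
have uB k : ((\col_k (k \in B)%:R : 'cV[F]_n) k 0 != 0) = (k \in B).
  by rewrite mxE pnatr_eq0 eqb0 negbK.
split=> //; rewrite (sum_support vA uB) -sum1_card natr_sum.
by apply: eq_bigr => k; rewrite inE !mxE => /andP[-> ->]; rewrite mulr1.
Qed.

Lemma exists_support_sum_eq0 : #|A :&: B| != 1%N ->
  exists v : 'rV[F]_n, exists u : 'cV[F]_n,
  [/\ forall k, (v 0 k != 0) = (k \in A), forall k, (u k 0 != 0) = (k \in B)
    & \sum_k v 0 k * u k 0 = 0].
Proof.
move=> card_neq1; have [v [u [vA uB vu]]] := exists_support_sum_card.
have [AB0|] := eqVneq #|A :&: B| 0%N; first by exists v, u; rewrite vu AB0.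
rewrite cards_eq0 => /set0Pn[k0 k0AB]; have := k0AB; rewrite inE => /andP[k0A k0B].
have cardE : #|A :&: B| = #|(A :&: B) :\ k0|.+1 by rewrite (cardsD1 k0) k0AB.
have m_neq0 : #|(A :&: B) :\ k0| != 0%N by apply: contra_neq card_neq1; lia.
pose v' : 'rV[F]_n := \row_k (k \in A)%:R.
(* The weight at [k0] cancels the ones contributed by the other common elements. There is at least
   one of these, so the weight is nonzero and the support is still [B]. *)
pose u' : 'cV[F]_n :=
  \col_k if k == k0 then - #|(A :&: B) :\ k0|%:R else (k \in B)%:R.
have vA' k : (v' 0 k != 0) = (k \in A) by rewrite mxE pnatr_eq0 eqb0 negbK.
have uB' k : (u' k 0 != 0) = (k \in B).
  rewrite mxE; case: (k =P k0) => [->|_]; first by rewrite oppr_eq0 pnatr_eq0 m_neq0 k0B.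
  by rewrite pnatr_eq0 eqb0 negbK.
exists v', u'; split=> //; rewrite (sum_support vA' uB') (big_setD1 k0) //=.
rewrite !mxE eqxx k0A mul1r; apply/eqP; rewrite addrC subr_eq0; apply/eqP.
rewrite -sum1_card natr_sum; apply: eq_bigr => k.
by rewrite !inE !mxE => /and3P[/negbTE-> -> ->]; rewrite mulr1.
Qed.

End SupportedVectors.

From mathcomp Require Import reals complex.

(** * Thin cells as support conditions, and incidence within their product *)

Section ThinCells.
Local Open Scope ring_scope.
Variables (R : realType) (n : nat).
Implicit Types (v w : 'rV[R[i]]_n) (u : 'cV[R[i]]_n) (W : {vspace 'rV[R[i]]_n}).

Lemma plucker_line v k : v != 0 -> (plucker <[v]> [set k] == 0) = (v 0 k == 0).
Proof.
move=> v_neq0; have card_dim : #|[set k]| = \dim <[v]>.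
  by rewrite cards1 dim_vline v_neq0.
apply/(vbasis_minor_eq0P card_dim)/eqP => [[w /vlineP[c ->]]|vk0].
  rewrite scaler_eq0 negb_or => -[/andP[/negbTE c_neq0 _] /(_ k (set11 k))/eqP].
  by rewrite mxE mulf_eq0 c_neq0 => /eqP.
exists v; first exact: memv_line.
by split=> // j; rewrite inE => /eqP->.
Qed.

(** A vector vanishing off [k] is a multiple of [delta_mx 0 k], so the minor vanishes exactly when
    that unit vector lies in the hyperplane. *)
Lemma plucker_hyperplane u k : u != 0 ->
  (plucker (hyperplane u) [set~ k] == 0) = (u k 0 == 0).
Proof.
move=> u_neq0; have card_dim : #|[set~ k]| = \dim (hyperplane u).
  by rewrite cardsC1 card_ord dim_hyperplane.
rewrite -delta_hyperplane.
apply/(vbasis_minor_eq0P card_dim)/idP => [[w wH [w_neq0 w0]]|kH]; last first.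
  exists (delta_mx 0 k) => //; split.
    by apply/eqP=> /rowP/(_ k)/eqP; rewrite !mxE !eqxx oner_eq0.
  by move=> j; rewrite !inE mxE => /negbTE->.
have wE : w = w 0 k *: delta_mx 0 k.
  apply/rowP=> j; rewrite !mxE eqxx /=; case: (j =P k) => [->|/eqP jk].
    by rewrite mulr1.
  by rewrite mulr0 w0 // !inE.
have wk_neq0 : w 0 k != 0.
  by apply: contra_neq w_neq0 => wk0; rewrite wE wk0 scale0r.
by rewrite -(scale1r (delta_mx 0 k)) -(mulVf wk_neq0) -scalerA -wE memvZ.
Qed.

Variable M : plurimatroid n.

Lemma thin_cell1P W : thin_cell M.1 W <->
  exists2 v, W = <[v]>%VS & forall k, (v 0 k != 0) = (k \in K1 M).
Proof.
split=> [[dimW plW]|[v -> vK]].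
  have v_neq0 : vpick W != 0 by rewrite vpick0 -dimv_eq0 dimW.
  have WE : W = <[vpick W]>%VS.
    apply/esym/eqP; rewrite eqEdim dim_vline v_neq0 dimW andbT.
    by rewrite -memvE memv_pick.
  exists (vpick W) => // k; rewrite inE -plucker_line // -WE.
  by apply/idP/idP => /(plW _ (cards1 k)).
(* A matroid has a basis, so the prescribed support is nonempty and [v] is nonzero. *)
have /set0Pn[k0 k0K] := K1_neq0 M.
have v_neq0 : v != 0.
  by apply/eqP=> v0; move: k0K; rewrite -vK v0 mxE eqxx.
split=> [|I /eqP/cards1P[k ->]]; first by rewrite /= /grassmannian /= dim_vline v_neq0.
by rewrite plucker_line // vK inE.
Qed.

Lemma thin_cell2P W : (0 < n)%N -> thin_cell M.2 W <->
  exists2 u, W = hyperplane u & forall k, (u k 0 != 0) = (k \in K2 M).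
Proof.
move=> n_gt0; have card_setC1 k : #|[set~ k] : {set 'I_n}| = n.-1.
  by rewrite cardsC1 card_ord.
split=> [[dimW plW]|[u -> uK]].
  have [u u_neq0 WE] := hyperplaneP n_gt0 dimW.
  exists u => // k; rewrite inE -plucker_hyperplane // -WE.
  by apply/idP/idP => /(plW _ (card_setC1 k)).
have /set0Pn[k0 k0K] := K2_neq0 M n_gt0.
have u_neq0 : u != 0.
  by apply/eqP=> u0; move: k0K; rewrite -uK u0 mxE eqxx.
split=> [|I cardI]; first exact: dim_hyperplane.
have /cards1P[k Ik]: #|~: I| == 1%N.
  by have := cardsC I; rewrite cardI card_ord => ?; apply/eqP; lia.
by rewrite -[I]setCK Ik plucker_hyperplane // uK inE.
Qed.

Lemma thin_cell_prodP (W : {vspace 'rV[R[i]]_n} * {vspace 'rV[R[i]]_n}) :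
  (0 < n)%N -> thin_cell_prod M W <->
  exists v, exists u, [/\ W = (<[v]>%VS, hyperplane u),
    forall k, (v 0 k != 0) = (k \in K1 M) & forall k, (u k 0 != 0) = (k \in K2 M)].
Proof.
move=> n_gt0; case: W => W1 W2; split.
  move=> [/= /thin_cell1P[v -> vK] /(thin_cell2P _ n_gt0)[u -> uK]].
  by exists v, u.
move=> [v [u [[-> ->] vK uK]]]; split; first by apply/thin_cell1P; exists v.
by apply/(thin_cell2P _ n_gt0); exists u.
Qed.

Lemma flag_cellP v u : (0 < n)%N ->
  (forall k, (v 0 k != 0) = (k \in K1 M)) ->
  (forall k, (u k 0 != 0) = (k \in K2 M)) ->
  flag_cell R M (<[v]>%VS, hyperplane u) <-> \sum_k v 0 k * u k 0 = 0.
Proof.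
move=> n_gt0 vK uK; split=> [[_ [_ _]]|/eqP sum0].
  by rewrite /= -memvE mem_hyperplane => /eqP.
have prodvu : thin_cell_prod M (<[v]>%VS, hyperplane u).
  by apply/thin_cell_prodP => //; exists v, u.
split=> //; have [[dim1 _] [dim2 _]] := prodvu.
by split; rewrite //= -memvE mem_hyperplane.
Qed.

Lemma flag_cell_neq0P : (0 < n)%N ->
  (exists V, flag_cell R M V) <-> #|K1 M :&: K2 M| != 1%N.
Proof.
move=> n_gt0; split=> [[V VM]|/(exists_support_sum_eq0 R[i])[v [u [vK uK sum0]]]].
  have [v [u [VE vK uK]]] := (thin_cell_prodP V n_gt0).1 VM.1.
  move: VM; rewrite VE => /(flag_cellP n_gt0 vK uK)/eqP.
  rewrite (sum_support vK uK); apply: contraL => /cards1P[k Kk].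
  have kK : k \in K1 M :&: K2 M by rewrite Kk set11.
  by rewrite Kk big_set1 mulf_eq0 negb_or vK uK -in_setI.
by exists (<[v]>%VS, hyperplane u); apply/(flag_cellP n_gt0).
Qed.

Lemma flag_cell_fullP : (0 < n)%N ->
  (forall V, thin_cell_prod M V -> flag_cell R M V) <->
  #|K1 M :&: K2 M| = 0%N.
Proof.
move=> n_gt0; split=> [full|K0 V /(thin_cell_prodP V n_gt0)[v [u [-> vK uK]]]].
  (* Fullness is tested on the indicator vectors: incidence then says that the cardinality is zero
     in [R[i]], hence in [nat]. *)
  have [v [u [vK uK sum_card]]] := exists_support_sum_card R[i] (K1 M) (K2 M).
  apply/eqP; rewrite -(pnatr_eq0 R[i]) -sum_card; apply/eqP/(flag_cellP n_gt0) => //.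
  by apply: full; apply/(thin_cell_prodP _ n_gt0); exists v, u.
apply/(flag_cellP n_gt0) => //; rewrite (sum_support vK uK).
by rewrite (cards0_eq K0) big_set0.
Qed.

End ThinCells.

From mathcomp Require Import all_classical all_reals.

Theorem proposition5p6 (R : realType) (n : nat) (n_ge3 : (3 <= n)%N)
    (M : plurimatroid n) :
  [/\ (flag_cell R M !=set0)%classic <-> is_flag_matroid M,
      is_flag_matroid M <-> #|(K1 M :&: K2 M)%SET| <> 1%N,
      complete_cell R M <-> #|(K1 M :&: K2 M)%SET| = 0%N
    & (flag_cell R M !=set0)%classic /\ proper_cell R M <->
        (2 <= #|(K1 M :&: K2 M)%SET|)%N].
Proof.
have n_gt0 : (0 < n)%N by apply: leq_trans n_ge3.
have flagE := is_flag_matroidE M n_gt0.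
have neq0E := flag_cell_neq0P R M n_gt0.
have fullE := flag_cell_fullP R M n_gt0.
have sub_prod : (flag_cell R M `<=` thin_cell_prod M)%classic by move=> W [].
split.
- by rewrite flagE; exact: neq0E.
- by rewrite flagE; split=> /eqP.
- rewrite -fullE; split=> [-> //|full].
  by rewrite /complete_cell eqEsubset.
(* Nonemptiness excludes cardinality 1. Strictness of the inclusion is the failure of the reverse
   inclusion, which by [fullE] excludes 0. *)
- split=> [[/neq0E card_neq1 [_ not_full]]|card_ge2].
    have card_neq0 : #|(K1 M :&: K2 M)%SET| <> 0%N by move/fullE.
    by move: card_neq1 card_neq0; case: #|_| => [|[]].
  split; first by apply/neq0E; move: card_ge2; case: #|_| => [|[]].
  by split=> // /fullE card0; rewrite card0 in card_ge2.
Qed.
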